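(* Let $\boldsymbol A(\mathfrak C)=\mathfrak C^*$ be a regular (branched or unbranched) covering, $\mathfrak C$ connected, where $\mathfrak C^*$ contains only a single point, has the singular segments $s_1^{*\pm1},s_2^{*\pm1},\dots$, and has the surface pieces $f_1^{*\pm1},\dots,f_n^{*\pm1}$ with simple boundary paths $r_1^*(s^* ),\dots,r_n^*(s^* )$; let $k_i-1$ be the branching number of the surface pieces of $\mathfrak C$ over $f_i^*$. Then the principal group $\mathfrak V$ of the covering has generators $S_1,S_2,\dots$ corresponding one-to-one to the segments $s_1^*,s_2^*,\dots$ and the defining relations $$r_i^*(S)^{k_i}=1\qquad(i=1,\dots,n),$$ where $r_i^*(S)$ results from $r_i^*(s^* )$ by replacing each $s_j^*$ by $S_j$.
   Context: A line segment complex consists of (finitely or denumerably many) points and directed segments; each segment $s$ has an initial and a final point and an oppositely directed segment $s^{-1}\ne s$, with $(s^{-1})^{-1}=s$, whose initial (final) point is the final (initial) point of $s$; a segment is singular if its initial and final points coincide. Paths are finite sequences of segments, each beginning where the preceding one ends. A surface complex is a line segment complex together with surface pieces $f$; each $f$ has an opposite $f^{-1}\neq f$, $(f^{-1})^{-1}=f$, and a closed path, determined up to cyclic interchange, circumscribing $f$ once positively (a simple positive boundary path of $f$); if $w$ is one for $f$, then $w^{-1}$ is one for $f^{-1}$. Covering (possibly branched) $\boldsymbol A(\mathfrak C)=\mathfrak C^*$ of surface complexes: a map of points, segments, surface pieces, surjective on points, such that (a) initial points are preserved, $\boldsymbol A(s^{-1})=\boldsymbol A(s)^{-1}$, $\boldsymbol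 A(f^{-1})=\boldsymbol A(f)^{-1}$, and the segments beginning at $p$ are mapped bijectively onto those beginning at $\boldsymbol A(p)$; (b) if $r$ is a simple positive boundary path of $f$, then $\boldsymbol A(r)={r^*}^k$ for a simple positive boundary path $r^*$ of $\boldsymbol A(f)$, and, writing $r=w_1\cdots w_k$ with $\boldsymbol A(w_i)=r^*$, the $w_i$ are pairwise distinct; (c) if $r^*$ is a simple positive boundary path of $f^*$ and $w'$ is a path with $\boldsymbol A(w')=r^*$, there is exactly one surface piece $f'$ over $f^*$ in whose simple positive boundary path $r'$ (suitably cyclically interchanged) $w'$ occurs as initial subpath. If $\boldsymbol A(r')={r^*}^k$, then $k-1$ is the branching number of $f'$. In $\mathfrak C^*$ each simple positive boundary path of a surface piece $f^*$ is assumed to bound only this surface piece positively. The covering is regular if, whenever $\boldsymbol A(w)=\boldsymbol A(w')$ and the path $w$ is closed, $w'$ is closed; for regular coverings the branching numbers of all surface pieces over the same $f^*$ are equal. The universal covering complex $\mathfrak K$ of $\mathfrak C$, with covering $\boldsymbol A'$, is the connected unbranched covering complex in which a path is closed iff its image in $\mathfrak C$ is closed and represents the identity of the fundamental group of $\mathfrak C$ (closed paths modulo insertion and deletion of $ss^{-1}$ and of simple boundary paths of surface pieces). Let $\boldsymbol A''=\boldsymbol A\circ\boldsymbol A'$, a regular covering of $\mathfrak C^*$ by $\mathfrak K$. The principal group $\mathfrak V$ of the regular covering is the group whose group diagram is the line segment complex of $\mathfrak K$: the factor group of the free group on $S_1,S_2,\dots$ by the normal subgroup of those words $W(S)$ for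 which the paths of $\mathfrak K$ lying (under $\boldsymbol A''$) over $W(s^* )$ are closed. *)

(* Defs.v *)
From HB Require Import structures.
From mathcomp Require Import all_boot.
From mathcomp Require Import boolp classical_sets.
From Stdlib Require Import Relation_Operators.

Set Implicit Arguments.
Unset Strict Implicit.
Unset Printing Implicit Defensive.

Local Open Scope group_scope.

(* [countType]: finitely or denumerably many points and segments. *)
Record line_complex := LineComplex {
  cpoint : countType;
  seg : countType;
  ini : seg -> cpoint;
  fin : seg -> cpoint;
  sinv : seg -> seg;
  sinvK : involutive sinv;
  sinv_neq : forall s, sinv s != s;
  ini_sinv : forall s, ini (sinv s) = fin s
}.

Arguments ini {l} s.
Arguments fin {l} s.
Arguments sinv {l} s.

Section Paths.
Variable C : line_complex.
Implicit Types (p : cpoint C) (w : seq (seg C)).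

Definition follows (s t : seg C) : bool := fin s == ini t.

(* [::] stands for the empty path at any point. *)
Definition is_path w : bool := sorted follows w.

(* [cycle] also compares the last segment with the first one. *)
Definition closed_path w : bool := cycle follows w.

Definition starts_at p w : bool := if w is s :: _ then ini s == p else true.

Definition path_from p w : bool := is_path w && starts_at p w.

Definition loop_at p w : bool := closed_path w && starts_at p w.

Definition path_inv w : seq (seg C) := rev (map sinv w).

Definition path_pow w (k : nat) : seq (seg C) := flatten (nseq k w).

Definition connected : Prop :=
  forall p q : cpoint C, p = q \/
    exists s w, [/\ is_path (s :: w), ini s = p & fin (last s w) = q].

End Paths.

(* [bdry f] is one of the simple positive boundary paths of [f]; the others are
   its cyclic interchanges, see [simple_bdry].  It is nonempty, as otherwise the
   exponent that defines the branching number would not be determined. *)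
Record surface_complex := SurfaceComplex {
  skeleton :> line_complex;
  piece : Type;
  popp : piece -> piece;
  poppK : involutive popp;
  popp_neq : forall f, popp f <> f;
  bdry : piece -> seq (seg skeleton);
  bdry_nonempty : forall f, bdry f != [::];
  bdry_closed : forall f, closed_path (bdry f);
  bdry_opp : forall f, exists i, path_inv (bdry f) = rot i (bdry (popp f))
}.

Arguments popp {s} p.
Arguments bdry {s} p.

Definition simple_bdry (C : surface_complex) (f : piece C)
    (r : seq (seg C)) : Prop :=
  exists i, r = rot i (bdry f).

Definition bounds_only_one (C : surface_complex) : Prop :=
  forall (f g : piece C) r, simple_bdry f r -> simple_bdry g r -> f = g.

Inductive insertion (C : surface_complex) : seq (seg C) -> seq (seg C) -> Prop :=
| insert_spur u v s : insertion (u ++ v) (u ++ [:: s; sinv s] ++ v)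
| insert_bdry u v f r :
    simple_bdry f r -> insertion (u ++ v) (u ++ r ++ v).

(* Every intermediate sequence is required to be a closed path at [p]. *)
Definition homotopic (C : surface_complex) (p : cpoint C) :
    seq (seg C) -> seq (seg C) -> Prop :=
  clos_refl_sym_trans _
    (fun w w' => [/\ loop_at p w, loop_at p w' & insertion w w']).

(* The closed path [w] represents the identity of the fundamental group at [p]. *)
Definition represents_identity (C : surface_complex) (p : cpoint C)
    (w : seq (seg C)) : Prop :=
  loop_at p w /\ homotopic p w [::].

Record complex_map (C D : surface_complex) := ComplexMap {
  on_point : cpoint C -> cpoint D;
  on_seg : seg C -> seg D;
  on_piece : piece C -> piece D
}.

Definition on_path (C D : surface_complex) (A : complex_map C D) :
    seq (seg C) -> seq (seg D) := map (on_seg A).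

Definition compose_map (C D E : surface_complex)
    (B : complex_map D E) (A : complex_map C D) : complex_map C E :=
  ComplexMap (on_point B \o on_point A) (on_seg B \o on_seg A)
             (on_piece B \o on_piece A).

(* In [cov_bdry], [ws] is the list of the subpaths w_1, ..., w_k that make up
   [r], and A(r) is the k-th power of [rs] with k = size ws. *)
Record is_covering (C D : surface_complex) (A : complex_map C D) : Prop := {
  cov_surj : forall q, exists p, on_point A p = q;
  cov_ini : forall s, ini (on_seg A s) = on_point A (ini s);
  cov_sinv : forall s, on_seg A (sinv s) = sinv (on_seg A s);
  cov_popp : forall f, on_piece A (popp f) = popp (on_piece A f);
  cov_star : forall p t, ini t = on_point A p ->
    exists! s, ini s = p /\ on_seg A s = t;
  cov_bdry : forall f r, simple_bdry f r ->
    exists rs ws,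
      [/\ simple_bdry (on_piece A f) rs,
          on_path A r = path_pow rs (size ws),
          r = flatten ws,
          {in ws, forall w, on_path A w = rs} &
          uniq ws];
  cov_lift : forall fs rs w, simple_bdry fs rs ->
    is_path w -> on_path A w = rs ->
    exists! f, on_piece A f = fs /\ exists2 r, simple_bdry f r & prefix w r
}.

Definition branching_number (C D : surface_complex) (A : complex_map C D)
    (f : piece C) (b : nat) : Prop :=
  exists r rs, [/\ simple_bdry f r, simple_bdry (on_piece A f) rs &
                   on_path A r = path_pow rs b.+1].

Definition unbranched (C D : surface_complex) (A : complex_map C D) : Prop :=
  forall f, branching_number A f 0.

Definition regular (C D : surface_complex) (A : complex_map C D) : Prop :=
  forall w w', is_path w -> is_path w' -> on_path A w = on_path A w' ->
    closed_path w -> closed_path w'.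

Record is_universal_covering (K C : surface_complex) (A : complex_map K C) :
    Prop := {
  univ_covering : is_covering A;
  univ_connected : connected K;
  univ_unbranched : unbranched A;
  univ_closed : forall p w, path_from p w ->
    (closed_path w <-> represents_identity (on_point A p) (on_path A w))
}.

(* The letter (j, false) is the j-th generator, (j, true) its inverse. *)
Definition word (J : Type) := seq (J * bool).

Section FreeGroup.
Variable J : choiceType.
Implicit Types (x y : J * bool) (u v w : word J).

Definition letter_inv x : J * bool := (x.1, ~~ x.2).

Lemma letter_invK : involutive letter_inv.
Proof. by case=> j b; rewrite /letter_inv /= negbK. Qed.

Definition reduced w : bool := sorted (fun x y => y != letter_inv x) w.

Definition push x w : word J :=
  if w is y :: w' then if y == letter_inv x then w' else x :: w else [:: x].

Definition reduce w : word J := foldr push [::] w.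

Lemma reduced_push x w : reduced w -> reduced (push x w).
Proof.
case: w => [|y w] //= yw; case: ifP => [_|yx]; first exact: path_sorted yw.
by rewrite /reduced /= yx.
Qed.

Lemma reduced_foldr u w : reduced w -> reduced (foldr push w u).
Proof. by move=> rw; elim: u => //= x u; apply: reduced_push. Qed.

Lemma reduced_reduce u : reduced (reduce u).
Proof. exact: reduced_foldr. Qed.

Lemma pushK x w : reduced w -> push x (push (letter_inv x) w) = w.
Proof.
case: w => [|y w] /=; first by rewrite eqxx.
rewrite letter_invK; case: eqP => [-> | _ _] /=; last by rewrite eqxx.
by case: w => [|z w] //= /andP[/negPf->].
Qed.

Lemma pushVK x w : reduced w -> push (letter_inv x) (push x w) = w.
Proof. by move=> rw; rewrite -{2}(letter_invK x) pushK. Qed.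

Lemma reduce_id w : reduced w -> reduce w = w.
Proof.
elim: w => //= x w IH xw; rewrite IH; last exact: path_sorted xw.
by case: w xw {IH} => //= y w /andP[/negPf->].
Qed.

Lemma foldr_reduce u w : reduced w -> foldr push w (reduce u) = foldr push w u.
Proof.
move=> rw; elim: u => //= x u <-; have := reduced_reduce u.
case: (reduce u) => //= y v _; case: eqP => [->|] //=.
by rewrite pushK //; apply: reduced_foldr.
Qed.

Lemma reduce_cat u v : reduce (u ++ v) = foldr push (reduce v) u.
Proof. by rewrite /reduce foldr_cat. Qed.

Record free_group := FreeGroup { fval : word J; _ : reduced fval }.

HB.instance Definition _ := [isSub for fval].
HB.instance Definition _ := [Choice of free_group by <:].

(* The element of the free group represented by an arbitrary word. *)
Definition fword w : free_group := FreeGroup (reduced_reduce w).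

Definition free_mul (u v : free_group) : free_group := fword (fval u ++ fval v).
Definition free_inv (u : free_group) : free_group := fword (rev (map letter_inv (fval u))).

Fact fval_reduced (u : free_group) : reduced (fval u). Proof. exact: valP. Qed.

Fact free_mulA : associative free_mul.
Proof.
move=> u v w; apply: val_inj => /=; have rw := fval_reduced w.
rewrite [LHS]reduce_cat [RHS]reduce_cat.
rewrite (reduce_id rw) (reduce_id (reduced_reduce _)).
by rewrite reduce_cat reduce_id // foldr_reduce // foldr_cat.
Qed.

Fact free_mul1g : left_id (fword [::]) free_mul.
Proof. by move=> u; apply: val_inj; rewrite /= reduce_id ?fval_reduced. Qed.

Fact free_mulg1 : right_id (fword [::]) free_mul.
Proof. by move=> u; apply: val_inj; rewrite /= cats0 reduce_id ?fval_reduced. Qed.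

Lemma foldr_invK u w : reduced w ->
  foldr push (foldr push w u) (rev (map letter_inv u)) = w.
Proof.
move=> rw; elim: u => //= x u IH.
by rewrite rev_cons foldr_rcons pushVK ?IH //; apply: reduced_foldr.
Qed.

Fact free_mulVg : left_inverse (fword [::]) free_inv free_mul.
Proof.
move=> u; apply: val_inj => /=.
by rewrite reduce_cat foldr_reduce ?reduced_reduce // foldr_invK.
Qed.

Fact free_mulgV : right_inverse (fword [::]) free_inv free_mul.
Proof.
move=> u; rewrite -[LHS]free_mul1g -{1}(free_mulVg (free_inv u)) -free_mulA.
by rewrite [X in free_mul _ X]free_mulA free_mulVg free_mul1g free_mulVg.
Qed.

HB.instance Definition _ :=
  isGroup.Build free_group free_mulA free_mul1g free_mulg1 free_mulVg free_mulgV.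

End FreeGroup.

(* W(S): the value of a word when the j-th generator is replaced by [S j]. *)
Definition feval (J : choiceType) (G : groupType) (S : J -> G)
    (W : free_group J) : G :=
  \prod_(x <- fval W) (if x.2 then (S x.1)^-1 else S x.1).

Definition normal_subgroup (G : groupType) (N : set G) : Prop :=
  [/\ N 1, (forall x y, N x -> N y -> N (x * y)),
      (forall x, N x -> N x^-1) & (forall x g, N x -> N (x ^ g))].

Definition normal_closure (G : groupType) (R : set G) : set G :=
  fun x => forall N : set G, normal_subgroup N ->
    (forall y, R y -> N y) -> N x.

Section FactorGroup.
Variables (G : groupType) (N : set G).

Lemma normal_closure_normal : normal_subgroup (normal_closure N).
Proof.
split=> [M [? ? ? ?] //|x y Nx Ny M nM NM|x Nx M nM NM|x g Nx M nM NM].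
- by have [_ MM _ _] := nM; apply: MM; [apply: Nx | apply: Ny].
- by have [_ _ MV _] := nM; apply: MV; apply: Nx.
- by have [_ _ _ MJ] := nM; apply: MJ; apply: Nx.
Qed.

Definition factor_rel : rel G := fun x y => `[< normal_closure N (x^-1 * y) >].

Fact factor_rel_refl : reflexive factor_rel.
Proof.
by move=> x; apply/asboolP; rewrite mulVg; case: normal_closure_normal.
Qed.

Fact factor_rel_sym : symmetric factor_rel.
Proof.
have [_ _ NV _] := normal_closure_normal.
by move=> x y; apply/asboolP/asboolP => /NV; rewrite invgM invgK.
Qed.

Fact factor_rel_trans : transitive factor_rel.
Proof.
have [_ NM _ _] := normal_closure_normal.
move=> y x z /asboolP xy /asboolP yz; apply/asboolP.
by have := NM _ _ xy yz; rewrite mulgA mulgK.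
Qed.

Definition factor_equiv : equiv_rel G :=
  EquivRel factor_rel factor_rel_refl factor_rel_sym factor_rel_trans.

(* The factor group of [G] by the smallest normal subgroup containing [N];
   it is G/N when [N] is itself a normal subgroup. *)
Definition factor_group := {eq_quot factor_equiv}%qT.

HB.instance Definition _ := Choice.on factor_group.

Definition factor_proj (x : G) : factor_group := (\pi_factor_group x)%qT.

Lemma factor_projP x y :
  factor_proj x = factor_proj y <-> normal_closure N (x^-1 * y).
Proof.
by split=> [/eqmodP /asboolP | /asboolP xy]; last exact/eqmodP.
Qed.

Definition factor_mul (a b : factor_group) : factor_group :=
  factor_proj (repr a * repr b).
Definition factor_inv (a : factor_group) : factor_group :=
  factor_proj (repr a)^-1.

Lemma repr_factor x : normal_closure N (x^-1 * repr (factor_proj x)).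
Proof. by apply/factor_projP; rewrite /factor_proj reprK. Qed.

Lemma factor_projM x y :
  factor_proj (x * y) = factor_mul (factor_proj x) (factor_proj y).
Proof.
apply/factor_projP; have [_ NM _ NJ] := normal_closure_normal.
have := NM _ _ (NJ _ y (repr_factor x)) (repr_factor y).
set a := repr _; set b := repr _.
by rewrite /conjg invgM !mulgA mulgK.
Qed.

Lemma factor_projV x : factor_proj x^-1 = factor_inv (factor_proj x).
Proof.
apply/factor_projP; have [_ _ NV NJ] := normal_closure_normal.
have := NJ _ x^-1 (NV _ (repr_factor x)); set a := repr _.
by rewrite /conjg invgM !invgK !mulgA mulgK.
Qed.

Lemma factorW (P : factor_group -> Prop) :
  (forall x, P (factor_proj x)) -> forall a, P a.
Proof. by move=> Px a; rewrite -[a]reprK; apply: Px. Qed.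

Fact factor_mulA : associative factor_mul.
Proof.
by elim/factorW=> x; elim/factorW=> y; elim/factorW=> z; rewrite -!factor_projM mulgA.
Qed.

Fact factor_mul1g : left_id (factor_proj 1) factor_mul.
Proof. by elim/factorW=> x; rewrite -factor_projM mul1g. Qed.

Fact factor_mulg1 : right_id (factor_proj 1) factor_mul.
Proof. by elim/factorW=> x; rewrite -factor_projM mulg1. Qed.

Fact factor_mulVg : left_inverse (factor_proj 1) factor_inv factor_mul.
Proof. by elim/factorW=> x; rewrite -factor_projV -factor_projM mulVg. Qed.

Fact factor_mulgV : right_inverse (factor_proj 1) factor_inv factor_mul.
Proof. by elim/factorW=> x; rewrite -factor_projV -factor_projM mulgV. Qed.

HB.instance Definition _ := isGroup.Build factor_group
  factor_mulA factor_mul1g factor_mulg1 factor_mulVg factor_mulgV.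

End FactorGroup.

(* [G] is generated by the [S j], with defining relations W(S) = 1, W in [R]. *)
Definition has_presentation (J : choiceType) (G : groupType) (S : J -> G)
    (R : set (free_group J)) : Prop :=
  (forall g, exists W, feval S W = g) /\
  (forall W, feval S W = 1 <-> normal_closure R W).

Definition signed_seg (J : Type) (C : line_complex) (s : J -> seg C)
    (x : J * bool) : seg C := if x.2 then sinv (s x.1) else s x.1.

Definition signed_piece (J : Type) (C : surface_complex) (f : J -> piece C)
    (x : J * bool) : piece C := if x.2 then popp (f x.1) else f x.1.

(* W(s): the sequence of segments spelled by the word W. *)
Definition word_path (J : Type) (C : line_complex) (s : J -> seg C)
    (W : word J) : seq (seg C) := map (signed_seg s) W.

Section PrincipalGroup.
Variables (J : choiceType) (K D : surface_complex).
Variables (A : complex_map K D) (s : J -> seg D).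

(* All paths lying over W(s) are closed. *)
Definition lifts_closed (W : word J) : Prop :=
  forall w, is_path w -> on_path A w = word_path s W -> closed_path w.

Definition principal_kernel : set (free_group J) :=
  [set fword W | W in lifts_closed]%classic.

Definition principal_group : groupType := factor_group principal_kernel.

Definition principal_gen (j : J) : principal_group :=
  factor_proj principal_kernel (fword [:: (j, false)]).

End PrincipalGroup.

(* Main.v *)
Require Import Defs.
From mathcomp Require Import all_boot.
From mathcomp Require Import boolp classical_sets.
From Stdlib Require Import Relation_Operators.

(** Since the base complex has a single point, every word in the generators is
    spelled by a path there, and lifting it from each point of the universal
    covering K gives an action of the free group on the points of K ([act]).
    The words all of whose lifts are closed are exactly those acting trivially
    ([principal_kernelE]); they therefore form a normal subgroup, and it remains
    to see that this subgroup is the normal closure N of the words r_i^k_i.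

    - r_i^k_i acts trivially.  Push a lift of it from K down to C: by the lifting
      axiom for surface pieces, the first factor r_i begins the boundary of a
      piece g over f_i, whose whole boundary lies over a k_i-th power, and this
      power can only be r_i^k_i ([lift_branched_bdry]).  So the path in C is a
      simple boundary path, hence null-homotopic, and its lift to K is closed.

    - A word W acting trivially lies in N.  A closed lift of W to K is pushed
      down to a null-homotopic closed path of C.  Label the segments of C by the
      generators they lie over: deleting a spur does not change the label of a
      path, and deleting a boundary path of a piece removes a conjugate of some
      r_i^k_i or of its inverse ([label_branched_bdry], [label_bdry_opp]).
      Hence membership of the label in N is a homotopy invariant
      ([homotopic_label]), and W, being the label of a null-homotopic path, is in
      N because 1 is.

    A single closed lift suffices in the second part, so a word with one closed
    lift has all its lifts closed. *)

Set Implicit Arguments.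
Unset Strict Implicit.
Unset Printing Implicit Defensive.

Local Open Scope group_scope.

(** * Powers and cyclic interchanges of paths *)

Section PathPowers.
Variable C : line_complex.
Implicit Types v w : seq (seg C).

Lemma path_powS w k : path_pow w k.+1 = w ++ path_pow w k.
Proof. by []. Qed.

Lemma rot1_path_pow w k : rot 1 (path_pow w k) = path_pow (rot 1 w) k.
Proof.
case: w => [|x w]; first by rewrite (_ : path_pow _ _ = [::]) //; elim: k.
have pow_rcons m : rcons (path_pow (x :: w) m) x = x :: path_pow (rcons w x) m.
  elim: m => // m IH.
  by rewrite !path_powS rcons_cat IH -cat_rcons rcons_cons.
rewrite rot1_cons; case: k => // k.
by rewrite !path_powS cat_cons rot1_cons rcons_cat pow_rcons cat_rcons.
Qed.

(** A cyclic interchange of a power is a power of a cyclic interchange, because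
    moving the first segment to the end does the same to the repeated path. *)
Lemma rot_path_pow w k i :
  exists j, rot i (path_pow w k) = path_pow (rot j w) k.
Proof.
elim: i => [|i [j IH]]; first by exists 0%N; rewrite !rot0.
have [lt_i|le_i] := ltnP i (size (path_pow w k)); last first.
  by exists 0%N; rewrite rot_oversize ?rot0 // ltnW.
exists (rot_add w j 1).
by rewrite rotS // IH rot1_path_pow rot_rot_add.
Qed.

Lemma prefix_path_pow v w k :
  size v = size w -> 0 < k -> prefix v (path_pow w k) -> v = w.
Proof.
move=> vw; case: k => // k _; rewrite prefixE path_powS vw take_size_cat //.
by move/eqP.
Qed.

End PathPowers.

Section Boundaries.
Variable C : surface_complex.
Implicit Types (g : piece C) (r : seq (seg C)).

Lemma simple_bdry_rot g r r' :
  simple_bdry g r -> simple_bdry g r' -> exists i, r' = rot i r.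
Proof.
move=> [i ->] [j ->]; exists (rot_add (rot i (bdry g)) (size (bdry g) - i) j).
by rewrite -rot_rot_add -[X in rot (X - i)](size_rot i) -/(rotr i _) rotK.
Qed.

Lemma simple_bdry_bdry g : simple_bdry g (bdry g).
Proof. by exists 0%N; rewrite rot0. Qed.

Lemma simple_bdry_neq0 g r : simple_bdry g r -> r != [::].
Proof.
by case=> i ->; rewrite -size_eq0 size_rot size_eq0; apply: bdry_nonempty.
Qed.

Lemma simple_bdry_closed g r : simple_bdry g r -> closed_path r.
Proof. by case=> i ->; rewrite /closed_path rot_cycle; apply: bdry_closed. Qed.

Lemma simple_bdry_opp g :
  simple_bdry (popp g) (path_inv (bdry g)).
Proof. by have [i ->] := bdry_opp g; exists i. Qed.

End Boundaries.

(** * Lifting paths *)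

Section Endpoints.
Variable C : line_complex.
Implicit Types (p : cpoint C) (w : seq (seg C)).

(** The empty path, which carries no point of its own, ends at [p]. *)
Definition path_end p w : cpoint C := last p (map fin w).

Lemma path_from_cons p t w :
  path_from p (t :: w) = (ini t == p) && path_from (fin t) w.
Proof.
rewrite /path_from /is_path /=; case: w => [|u w] /=; first by rewrite andbT.
by rewrite andbC /follows [fin t == _]eq_sym [path _ _ _ && _]andbC.
Qed.

Lemma path_from_cat p v w :
  path_from p (v ++ w) = path_from p v && path_from (path_end p v) w.
Proof.
elim: v p => [|t v IH] p //.
by rewrite cat_cons !path_from_cons IH andbA.
Qed.

Lemma is_path_from w : is_path w -> w = [::] \/ exists p, path_from p w.
Proof.
by case: w => [|t w] pw; [left | right; exists (ini t); rewrite /path_from pw /=].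
Qed.

Lemma path_end_cat p v w : path_end p (v ++ w) = path_end (path_end p v) w.
Proof. by rewrite /path_end map_cat last_cat. Qed.

Lemma closed_pathE p w : path_from p w -> closed_path w = (path_end p w == p).
Proof.
case: w => [|t w]; first by rewrite /path_end eqxx.
case/andP=> pw /eqP <-; rewrite /closed_path /= rcons_path.
by rewrite [path _ _ _]pw /follows /path_end /= last_map.
Qed.

Lemma closed_path_is_path w : closed_path w -> is_path w.
Proof. by case: w => // t w; rewrite /closed_path /= rcons_path => /andP[]. Qed.

Lemma fin_sinv (t : seg C) : fin (sinv t) = ini t.
Proof. by rewrite -ini_sinv sinvK. Qed.

End Endpoints.

(** The part of the covering axioms that concerns segments.  It is stable under
    composition, so that paths can be lifted along the composite of the two
    coverings without any analysis of its branching. *)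
Record segment_covering (C D : surface_complex) (A : complex_map C D) : Prop := {
  scov_ini : forall s, ini (on_seg A s) = on_point A (ini s);
  scov_sinv : forall s, on_seg A (sinv s) = sinv (on_seg A s);
  scov_star : forall p t, ini t = on_point A p ->
    exists! s, ini s = p /\ on_seg A s = t
}.

Lemma covering_segment (C D : surface_complex) (A : complex_map C D) :
  is_covering A -> segment_covering A.
Proof.
by move=> cA; split; [apply: cov_ini | apply: cov_sinv | apply: cov_star].
Qed.

Lemma compose_segment_covering (C D E : surface_complex)
    (B : complex_map D E) (A : complex_map C D) :
  segment_covering B -> segment_covering A ->
  segment_covering (compose_map B A).
Proof.
move=> cB cA; split=> [t|t|p t /= tp] /=.
- by rewrite !scov_ini.
- by rewrite !scov_sinv.
have [u [[up ut] uU]] := scov_star cB tp.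
have [v [[vp vu] vU]] := scov_star cA up.
exists v; split=> [|v' [v'p v't]]; first by rewrite vu.
by apply: vU; split=> //; symmetry; apply: uU; rewrite scov_ini // v'p.
Qed.

Lemma on_path_compose (C D E : surface_complex) (B : complex_map D E)
    (A : complex_map C D) w :
  on_path (compose_map B A) w = on_path B (on_path A w).
Proof. exact: map_comp. Qed.

Section Lifting.
Variables (C D : surface_complex) (A : complex_map C D).
Hypothesis cA : segment_covering A.

Lemma scov_fin t : fin (on_seg A t) = on_point A (fin t).
Proof. by rewrite -!ini_sinv -scov_sinv // scov_ini. Qed.

Lemma path_from_on_path p w :
  path_from p w -> path_from (on_point A p) (on_path A w).
Proof.
elim: w p => // t w IH p; rewrite /on_path /= !path_from_cons.
by case/andP=> /eqP <- /IH; rewrite scov_ini // eqxx scov_fin.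
Qed.

Lemma lift_path p w : path_from (on_point A p) w ->
  exists2 v, path_from p v & on_path A v = w.
Proof.
elim: w p => [|t w IH] p; first by exists [::].
rewrite path_from_cons => /andP[/eqP tp].
have [u [[up <-] _]] := scov_star cA tp; rewrite scov_fin => /IH[v pv <-].
by exists (u :: v); rewrite // path_from_cons up eqxx.
Qed.

Lemma lift_unique p v w : path_from p v -> path_from p w ->
  on_path A v = on_path A w -> v = w.
Proof.
elim: v p w => [|t v IH] p [|u w] //; rewrite !path_from_cons.
case/andP=> /eqP tp pv /andP[/eqP up pw] [tu vw].
have [x [_ xU]] : exists! x, ini x = p /\ on_seg A x = on_seg A t.
  by apply: scov_star; rewrite // scov_ini // tp.
have eq_tu : t = u by rewrite -(xU t) // -(xU u).
by rewrite -{}eq_tu in pw *; rewrite (IH (fin t) w).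
Qed.

End Lifting.

(** * Words and elements of the free group *)

Section Words.
Variable J : choiceType.
Implicit Types (x : J * bool) (u v w : word J) (g : free_group J).

Lemma fword_fval g : fword (fval g) = g.
Proof. by apply: val_inj; rewrite /= reduce_id // fval_reduced. Qed.

Lemma fword_cat u v : fword (u ++ v) = fword u * fword v.
Proof.
apply: val_inj; rewrite /= !reduce_cat foldr_reduce ?reduced_reduce //.
by rewrite (reduce_id (reduced_reduce v)).
Qed.

Lemma fword_prod u : fword u = \prod_(x <- u) fword [:: x].
Proof.
elim: u => [|x u IH]; first by rewrite big_nil.
by rewrite big_cons -IH -fword_cat.
Qed.

Lemma fword_letter_inv x : fword [:: letter_inv x] = (fword [:: x])^-1.
Proof. by apply: val_inj. Qed.

Lemma fword_pow u k : fword (flatten (nseq k u)) = fword u ^+ k.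
Proof. by elim: k => // k IH; rewrite fword_cat IH expgS. Qed.

Lemma word_path_pow (C : line_complex) (s : J -> seg C) u k :
  word_path s (flatten (nseq k u)) = path_pow (word_path s u) k.
Proof. by rewrite /word_path map_flatten map_nseq. Qed.

End Words.

Section NormalSubgroups.
Variables (G : groupType) (N : set G).
Hypothesis nN : normal_subgroup N.

Lemma normal_conj x y : N (x ^ y) <-> N x.
Proof.
have [_ _ _ NJ] := nN; split; last exact: NJ.
by move/(NJ _ y^-1); rewrite conjgK.
Qed.

Lemma normal_inv x : N x^-1 <-> N x.
Proof.
have [_ _ NV _] := nN; split; last exact: NV.
by move/NV; rewrite invgK.
Qed.

Lemma normal_mull x y : N x -> (N (x * y) <-> N y).
Proof.
have [_ NM NV _] := nN; move=> Nx; split=> [|/(NM _ _ Nx)//].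
by move/(NM _ _ (NV _ Nx)); rewrite mulKg.
Qed.

Lemma normal_insert x y z : N y -> (N (x * (y * z)) <-> N (x * z)).
Proof.
move=> Ny; rewrite (_ : _ * _ = (y ^ x^-1) * (x * z)).
  by apply: normal_mull; apply/normal_conj.
by rewrite conjgE invgK !mulgA mulgVK.
Qed.

Lemma normal_closureE : normal_closure N = N.
Proof.
apply/funext => x; apply/propext; split=> [|Nx M _]; last exact.
by apply.
Qed.

End NormalSubgroups.

Lemma normal_closure_sub (G : groupType) (R : set G) x :
  R x -> normal_closure R x.
Proof. by move=> Rx M _; apply. Qed.

(** * Labelling segments by group elements *)

Section Labels.
Variables (C : surface_complex) (G : groupType) (phi : seg C -> G).
Implicit Types (v w : seq (seg C)) (g : piece C).

(** For the labelling of segments by generators of a free group this reads off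
    the group element spelled by a path. *)
Definition label w : G := \prod_(t <- w) phi t.

Lemma label_cat v w : label (v ++ w) = label v * label w.
Proof. by rewrite /label big_cat. Qed.

Lemma label_pow w k : label (path_pow w k) = label w ^+ k.
Proof.
elim: k => [|k IH]; first by rewrite /label big_nil.
by rewrite path_powS label_cat IH expgS.
Qed.

Lemma label_rot i w : label (rot i w) = label w ^ label (take i w).
Proof.
rewrite /rot label_cat -{3}(cat_take_drop i w) label_cat conjgE.
by rewrite -mulgA mulKg.
Qed.

Variable N : set G.
Hypothesis nN : normal_subgroup N.

Lemma label_simple_bdry g r r' : simple_bdry g r -> simple_bdry g r' ->
  N (label r) <-> N (label r').
Proof.
move=> gr gr'; have [i ->] := simple_bdry_rot gr gr'.
by rewrite label_rot normal_conj.
Qed.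

Hypothesis phi_sinv : forall t, phi (sinv t) = (phi t)^-1.

Lemma label_path_inv w : label (path_inv w) = (label w)^-1.
Proof.
elim: w => [|t w IH]; first by rewrite /label /path_inv !big_nil invg1.
rewrite /path_inv /= rev_cons -cats1 label_cat [label (rev _)]IH.
by rewrite /label big_seq1 big_cons phi_sinv invgM.
Qed.

(** The boundaries of opposite pieces have inverse labels up to conjugation. *)
Lemma label_bdry_opp g : N (label (bdry (popp g))) <-> N (label (bdry g)).
Proof.
rewrite -(label_simple_bdry (simple_bdry_opp g) (simple_bdry_bdry _)).
by rewrite label_path_inv normal_inv.
Qed.

(** Modulo N neither kind of insertion changes the label: a spur contributes
    x x^-1, and a boundary path contributes a factor in N, which may be removed
    from the middle of a product since N is normal. *)
Lemma homotopic_label p w w' :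
  (forall g, N (label (bdry g))) -> homotopic p w w' ->
  N (label w) <-> N (label w').
Proof.
move=> Nbdry; elim=> [v v' [_ _]|v|v v' _ [? ?]|u v v' _ [? ?] _ [? ?]] //; last by split; auto.
case=> [u u' t|u u' g r gr]; rewrite !label_cat.
  by rewrite [label [:: t; _]]big_cons big_seq1 phi_sinv mulgV mul1g.
symmetry; apply: normal_insert => //.
by apply/(label_simple_bdry gr (simple_bdry_bdry g)).
Qed.

End Labels.

(** * Boundaries of surface pieces in a covering *)

Lemma label_on_path (C D : surface_complex) (A : complex_map C D)
    (G : groupType) (phi : seg D -> G) w :
  label (phi \o on_seg A) w = label phi (on_path A w).
Proof. by rewrite /label big_map. Qed.

(** The boundary of [g] lies over a k-th power of a cyclic interchange of [rs],
    whose label is conjugate to the k-th power of that of [rs]. *)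
Lemma label_branched_bdry (C D : surface_complex) (A : complex_map C D)
    (G : groupType) (phi : seg D -> G) (N : set G) g rs k :
  normal_subgroup N -> branching_number A g k.-1 -> 0 < k ->
  simple_bdry (on_piece A g) rs -> N (label phi rs ^+ k) ->
  N (label (phi \o on_seg A) (bdry g)).
Proof.
move=> nN [r [rs' [gr grs' Ar]]] k0 grs; rewrite prednK // in Ar.
have [i ->] := simple_bdry_rot grs' grs.
rewrite label_rot -conjXg (normal_conj nN) -label_pow -Ar -label_on_path.
exact: (label_simple_bdry _ nN (simple_bdry_bdry g) gr).2.
Qed.

(** Some piece [g] over [fs] has a boundary path [r] beginning with the lift of
    [rs].  As [r] lies over a cyclic interchange of a k-th power of a boundary
    path of [fs], it lies over the k-th power of a path as long as [rs]; the
    beginning of [r] shows that this path is [rs]. *)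
Lemma lift_branched_bdry (C D : surface_complex) (A : complex_map C D)
    (fs : piece D) rs k q :
  is_covering A -> 0 < k ->
  (forall g, on_piece A g = fs -> branching_number A g k.-1) ->
  simple_bdry fs rs -> path_from (on_point A q) rs ->
  exists g r, [/\ simple_bdry g r, starts_at q r & on_path A r = path_pow rs k].
Proof.
move=> cA k0 brA frs /(lift_path (covering_segment cA))[w qw Aw].
have /andP[pw sw] := qw.
have [g [[gf [r gr wr]] _]] := cov_lift cA frs pw Aw.
exists g, r; split=> //.
  case: w {pw qw} Aw wr sw => [rs0|t w _ /prefixP[w' ->]] //.
  by have := simple_bdry_neq0 frs; rewrite -rs0.
have [r1 [rs1 [gr1 frs1 Ar1]]] := brA g gf; rewrite prednK // in Ar1.
have [i rE] := simple_bdry_rot gr1 gr.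
have Ar : on_path A r = rot i (path_pow rs1 k) by rewrite rE -Ar1 /on_path map_rot.
have [j rotE] := rot_path_pow rs1 k i; rewrite Ar rotE.
congr path_pow; symmetry; apply: (@prefix_path_pow _ _ _ k) => //.
  rewrite gf in frs1; have [l ->] := simple_bdry_rot frs1 frs.
  by rewrite !size_rot.
by rewrite -rotE -Ar -Aw; case/prefixP: wr => w' ->; rewrite /on_path map_cat prefix_prefix.
Qed.

(** * The action of the free group on the points of a covering complex *)

Section WordAction.
Variables (J : choiceType) (K D : surface_complex) (A : complex_map K D).
Variables (s : J -> seg D).
Hypothesis cA : segment_covering A.
Hypothesis D_point : forall p q : cpoint D, p = q.
Implicit Types (p q : cpoint K) (W : word J).

Lemma any_path_from (q : cpoint D) w : path_from q w.
Proof.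
elim: w q => // t w IH q.
by rewrite path_from_cons IH (D_point (ini t) q) eqxx.
Qed.

Definition word_lift p W : seq (seg K) :=
  s2val (cid2 (lift_path cA (any_path_from (on_point A p) (word_path s W)))).

Lemma word_lift_from p W : path_from p (word_lift p W).
Proof. by rewrite /word_lift; case: cid2. Qed.

Lemma on_word_lift p W : on_path A (word_lift p W) = word_path s W.
Proof. by rewrite /word_lift; case: cid2. Qed.

Definition act p W : cpoint K := path_end p (word_lift p W).

Lemma actE p W w : path_from p w -> on_path A w = word_path s W ->
  act p W = path_end p w.
Proof.
move=> pw Aw; congr path_end.
by apply: (lift_unique cA (word_lift_from p W) pw); rewrite on_word_lift.
Qed.

Lemma act_cat p U W : act p (U ++ W) = act (act p U) W.
Proof.
rewrite [RHS]/act {1}/act -path_end_cat; apply: actE.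
  by rewrite path_from_cat !word_lift_from.
by rewrite /word_path /on_path !map_cat -!/(on_path A _) !on_word_lift.
Qed.

Lemma act_nil p : act p [::] = p.
Proof. exact: (@actE p [::] [::]). Qed.

Lemma act_cons p x W : act p (x :: W) = act (act p [:: x]) W.
Proof. by rewrite -cat1s act_cat. Qed.

Lemma signed_seg_inv x : signed_seg s (letter_inv x) = sinv (signed_seg s x).
Proof. by case: x => j [] //=; rewrite /signed_seg /= sinvK. Qed.

Lemma act_spur p x : act p [:: x; letter_inv x] = p.
Proof.
have := word_lift_from p [:: x]; have := on_word_lift p [:: x].
case: (word_lift p [:: x]) => [|t [|//]] // [At].
rewrite path_from_cons andbT => /eqP tp.
rewrite (@actE p _ [:: t; sinv t]).
- by rewrite /path_end /= fin_sinv.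
- by rewrite !path_from_cons ini_sinv tp !eqxx.
- by rewrite /on_path /word_path /= scov_sinv // At signed_seg_inv.
Qed.

(** Freely equal words act alike, since the lift of a spur returns to its
    starting point; this makes [act] an action of the free group. *)
Lemma act_reduce p W : act p (reduce W) = act p W.
Proof.
elim: W p => // x W IH p; rewrite [RHS]act_cons -IH -act_cons /=.
case: (reduce W) => //= y U; case: eqP => // ->.
by rewrite -(cat1s x) -(cat1s (letter_inv x)) catA act_cat act_spur.
Qed.

Lemma lifts_closedE W : lifts_closed A s W <-> forall p, act p W = p.
Proof.
split=> [cW p|aW w /is_path_from[-> //|[p pw]] Aw].
  apply/eqP; rewrite -(closed_pathE (word_lift_from p W)).
  by apply: cW (on_word_lift p W); case/andP: (word_lift_from p W).
by rewrite (closed_pathE pw) -(actE pw Aw) aW.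
Qed.

(** The principal kernel is the kernel of the action on points. *)
Lemma principal_kernelE g :
  principal_kernel A s g <-> forall p, act p (fval g) = p.
Proof.
split=> [[W /lifts_closedE aW <-] p|ag]; first by rewrite /= act_reduce.
by exists (fval g); [apply/lifts_closedE | apply: fword_fval].
Qed.

Lemma principal_kernel_fword W :
  principal_kernel A s (fword W) <-> forall p, act p W = p.
Proof. by rewrite principal_kernelE; split=> aW p; rewrite -{2}(aW p) act_reduce. Qed.

Lemma principal_kernel_normal : normal_subgroup (principal_kernel A s).
Proof.
have actM p (x y : free_group J) : act p (fval (x * y)) = act (act p (fval x)) (fval y).
  by rewrite -act_cat -[RHS]act_reduce.
have act1 p : act p (fval (1 : free_group J)) = p by apply: act_nil.
have actVK (x : free_group J) p : act (act p (fval x^-1)) (fval x) = p.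
  by rewrite -actM mulVg act1.
split=> [|x y|x|x y].
- by rewrite principal_kernelE.
- by rewrite !principal_kernelE => ax ay p; rewrite actM ax ay.
- by rewrite !principal_kernelE => ax p; rewrite -[LHS]ax actVK.
- by rewrite !principal_kernelE => ax p; rewrite conjgE !actM ax actVK.
Qed.

End WordAction.

(** * Presentations of the principal group *)

Section Presentation.
Variables (J : choiceType) (K D : surface_complex) (A : complex_map K D).
Variables (s : J -> seg D).

Lemma feval_principal (W : free_group J) :
  feval (G := principal_group A s) (principal_gen A s) W =
  factor_proj (principal_kernel A s) W.
Proof.
rewrite -{2}(fword_fval W) fword_prod.
rewrite (big_morph _ (@factor_projM _ _) (erefl (factor_proj _ 1))).
apply: eq_bigr => -[j []] _ //=.
by rewrite /principal_gen -[RHS]/(factor_proj _ (fword [:: letter_inv (j, false)]))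
  fword_letter_inv factor_projV.
Qed.

Lemma principal_presentation R : normal_subgroup (principal_kernel A s) ->
  principal_kernel A s = normal_closure R ->
  has_presentation (G := principal_group A s) (principal_gen A s) R.
Proof.
move=> nker kerE; split=> [|W].
  by elim/factorW=> x; exists x; rewrite feval_principal.
rewrite feval_principal -kerE -[X in _ <-> X W](normal_closureE nker).
have := factor_projP (principal_kernel A s) 1 W; rewrite invg1 mul1g => <-.
by split=> [|<-].
Qed.

End Presentation.

(** * The defining relations of the principal group *)

Theorem mainTheorem3
  (C Cs K : surface_complex)
  (A : complex_map C Cs) (A' : complex_map K C)
  (J : countType) (s : J -> seg Cs)
  (n : nat) (f : 'I_n -> piece Cs) (r : 'I_n -> word J) (k : 'I_n -> nat)
  (Cs_unique : bounds_only_one Cs)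
  (A_covering : is_covering A)
  (A_regular : regular A)
  (C_connected : connected C)
  (A'_universal : is_universal_covering A')
  (Cs_point : exists p0 : cpoint Cs, forall p : cpoint Cs, p = p0)
  (Cs_segs : bijective (signed_seg s))
  (Cs_pieces : bijective (signed_piece f))
  (r_bdry : forall i, simple_bdry (f i) (word_path s (r i)))
  (k_pos : forall i, 0 < k i)
  (k_branching : forall i g, on_piece A g = f i ->
     branching_number A g (k i).-1) :
  let A'' := compose_map A A' in
  normal_subgroup (principal_kernel A'' s) /\
  has_presentation (G := principal_group A'' s) (principal_gen A'' s)
    [set fword (r i) ^+ k i | i in [set: 'I_n]]%classic.
Proof.
move=> A''.
have cA := covering_segment A_covering.
have cA' := covering_segment (univ_covering A'_universal).
have cA'' : segment_covering A'' by apply: compose_segment_covering.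
have D_point (p q : cpoint Cs) : p = q.
  by case: Cs_point => p0 p0P; rewrite (p0P p) (p0P q).
have nker := principal_kernel_normal s cA'' D_point.
split=> //; apply: principal_presentation => //.
set R := (X in normal_closure X).
apply/funext => g; apply/propext; split; last first.
  apply=> // _ [i _ <-].
  rewrite -fword_pow (principal_kernel_fword s cA'' D_point) => p.
  set W := flatten _.
  (* The path of K over r_i^k_i from p projects to a boundary path v in C. *)
  have [h [v [hv vp Av]]] := lift_branched_bdry A_covering (k_pos i)
    (k_branching i) (r_bdry i) (any_path_from D_point (on_point A (on_point A' p)) _).
  have cv := simple_bdry_closed hv.
  have pv : path_from (on_point A' p) v by rewrite /path_from closed_path_is_path.
  have pw := word_lift_from s cA'' D_point p W.
  have Aw := on_word_lift s cA'' D_point p W.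
  have A'w : on_path A' (word_lift s cA'' D_point p W) = v.
    apply: (lift_unique cA (path_from_on_path cA' pw) pv).
    by rewrite Av -word_path_pow -Aw on_path_compose.
  apply/eqP; rewrite -(closed_pathE pw) (univ_closed A'_universal pw) A'w.
  have lv : loop_at (on_point A' p) v by rewrite /loop_at cv.
  split=> //; apply/rst_sym/rst_step; split=> //.
  by rewrite -[v]cats0; apply: (@insert_bdry C [::] [::] h).
rewrite (principal_kernelE s cA'' D_point) => ag.
have nN := normal_closure_normal R.
set N := normal_closure R in nN *.
(* Conversely, one closed lift of g, from any point of K, puts g in N. *)
have [p _] : exists p : cpoint K, True.
  have [q _] := Cs_point; have [q' _] := cov_surj A_covering q.
  by have [p _] := cov_surj (univ_covering A'_universal) q'; exists p.
have [sigma sK Ks] := Cs_segs.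
have phi_sinv t : fword [:: sigma (sinv t)] = (fword [:: sigma t])^-1.
  by rewrite -fword_letter_inv -[in LHS](Ks t) -signed_seg_inv sK.
pose phi t := fword [:: sigma t].
have label_word W : label phi (word_path s W) = fword W.
  by rewrite /label big_map fword_prod; apply: eq_bigr => x _; rewrite /phi sK.
have phiA_sinv t : (phi \o on_seg A) (sinv t) = ((phi \o on_seg A) t)^-1.
  by rewrite /= scov_sinv // /phi phi_sinv.
(* Pieces over f_i are treated directly, those over its opposite through their
   own opposites. *)
have Npos h i : on_piece A h = f i -> N (label (phi \o on_seg A) (bdry h)).
  move=> hi; apply: (label_branched_bdry nN (k_branching i h hi) (k_pos i)).
    by rewrite hi; apply: r_bdry.
  by rewrite label_word; apply: normal_closure_sub; exists i.
have Nbdry h : N (label (phi \o on_seg A) (bdry h)).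
  have [tau _ Kt] := Cs_pieces; have := Kt (on_piece A h).
  case: (tau _) => i [] hi; last exact: (Npos h i).
  apply/(label_bdry_opp nN phiA_sinv); apply: (Npos _ i).
  by rewrite cov_popp // -hi /signed_piece /= poppK.
have pw := word_lift_from s cA'' D_point p (fval g).
have Aw := on_word_lift s cA'' D_point p (fval g).
have cw : closed_path (word_lift s cA'' D_point p (fval g)).
  by rewrite (closed_pathE pw); apply/eqP; apply: ag.
have [_ hw] := (univ_closed A'_universal pw).1 cw.
have /(homotopic_label nN phiA_sinv Nbdry) [_] := hw.
rewrite !label_on_path -on_path_compose Aw label_word fword_fval.
by apply; rewrite /label big_nil; case: nN.
Qed.
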